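(* Let $G$ be a group and let $R$ be a $G$-ring, i.e. a ring equipped with a group homomorphism $\theta: G\to\mathrm{Aut}_{\mathrm{Ring}}(R)$. Then for any $R$-module $M$, regarded as an object $\chi: R\to \mathrm{End}_{\mathrm{Ab}}(M)$ of $R/\mathrm{Ring}$, there is a natural isomorphism (bijection of sets, natural in the objects $\theta: G \to \mathrm{Aut}_{\mathrm{Ring}}(R)$ of $\mathrm{Grp}/\mathrm{Aut}_{\mathrm{Ring}}(R)$ and $\chi: R\to\mathrm{End}_{\mathrm{Ab}}(M)$ of $R/\mathrm{Ring}$) $$\mathrm{Hom}_{R/\mathrm{Ring}}\left(R_\theta[G], \mathrm{End}_{\mathrm{Ab}}(M)\right)\cong \mathrm{Hom}_{\mathrm{Grp}/\mathrm{Aut}_{\mathrm{Ring}}(R)}\left(G, \mathrm{Aut}_{\mathrm{Mod}^{\mathrm{semi}}(R)}(M)\right).$$ The left side is the set of extensions of the $R$-module structure on $M$ to an $R_\theta[G]$-module structure, and the right side is the set of semilinear $G$-actions on $M$ compatible with the $G$-action $\theta$ on $R$.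
   Context: Rings are associative and unital, not necessarily commutative, and ring homomorphisms are unital; modules are left modules. $\mathrm{Aut}_{\mathrm{Ring}}(R)$ is the group of ring automorphisms of $R$ under composition. $\mathrm{End}_{\mathrm{Ab}}(M)$ is the endomorphism ring of the underlying abelian group of $M$, with multiplication given by composition; an $R$-module structure on $M$ is the same as a ring homomorphism $\chi: R\to\mathrm{End}_{\mathrm{Ab}}(M)$. Categories. $\mathrm{Grp}/\mathrm{Aut}_{\mathrm{Ring}}(R)$ is the slice category: objects are group homomorphisms to $\mathrm{Aut}_{\mathrm{Ring}}(R)$, and morphisms are group homomorphisms commuting with the maps to $\mathrm{Aut}_{\mathrm{Ring}}(R)$. $R/\mathrm{Ring}$ is the category of rings under $R$: objects are ring homomorphisms out of $R$, and morphisms are ring homomorphisms commuting with the maps from $R$. Write $\theta_g$ for $\theta(g)$. Twisted group ring. $R_\theta[G]$ has the same elements and addition as the group ring $R[G]$, with multiplication the additive extension of $(r_1g_1)\cdot(r_2g_2) := r_1\theta_{g_1}(r_2)\,g_1g_2$; it is an object of $R/\mathrm{Ring}$ via $r\mapsto r1_G$. A morphism $j$ from $\theta: G \to \mathrm{Aut}_{\mathrm{Ring}}(R)$ to $\psi: K \to \mathrm{Aut}_{\mathrm{Ring}}(R)$ in the slice category induces $R_\theta[G]\to R_\psi[K]$, $rg\mapsto r\,j(g)$. Semilinear maps. For $\phi\in\mathrm{Aut}_{\mathrm{Ring}}(R)$, a $\phi$-semilinear map $f: M\to N$ of $R$-modules is a function with $f(m+m')=f(m)+f(m')$ and $f(rm)=\phi(r)f(m)$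 for all $m,m'\in M$, $r\in R$. $\mathrm{Mod}^{\mathrm{semi}}(R)$ is the category of $R$-modules with all semilinear maps, where each morphism carries its automorphism $\phi$; if $f$ is $\phi$-semilinear and $g$ is $\omega$-semilinear, then $gf$ is $(\omega\circ\phi)$-semilinear. Thus $$\mathrm{Aut}_{\mathrm{Mod}^{\mathrm{semi}}(R)}(M)=\{(\sigma,\phi)\in\mathrm{End}_{\mathrm{Ab}}(M)^\times\times\mathrm{Aut}_{\mathrm{Ring}}(R)\mid \sigma\circ\chi(r)=\chi(\phi(r))\circ\sigma\ \text{ for all } r\in R\},$$ a group under componentwise composition, and an object of $\mathrm{Grp}/\mathrm{Aut}_{\mathrm{Ring}}(R)$ via $U:(\sigma,\phi)\mapsto\phi$. A ring homomorphism $h:\mathrm{End}_{\mathrm{Ab}}(M)\to\mathrm{End}_{\mathrm{Ab}}(N)$ under $R$ induces $(\sigma,\phi)\mapsto(h(\sigma),\phi)$ on these groups. A semilinear $G$-action on $M$ compatible with $\theta$ is a group homomorphism $f: G\to\mathrm{Aut}_{\mathrm{Mod}^{\mathrm{semi}}(R)}(M)$ with $U\circ f=\theta$; explicitly, a $\theta_g$-semilinear map $f(g)$ for each $g\in G$ with $f(e)=\mathrm{id}$ and $f(gh)=f(g)f(h)$. *)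

(* Defs.v *)
From HB Require Import structures.
From mathcomp Require Import all_boot all_algebra finmap monalg.
From mathcomp Require Import boolp.

Set Implicit Arguments.
Unset Strict Implicit.
Unset Printing Implicit Defensive.

Import GRing.Theory.

Local Open Scope ring_scope.

Notation "{ 'grphom' G -> H }" := (UMagmaMorphism.type G H)
  (at level 0, G at level 98, H at level 99, format "{ 'grphom'  G  ->  H }")
  : type_scope.

Lemma additive_ext (U V : zmodType) (f g : {additive U -> V}) :
  f =1 g -> f = g.
Proof.
case: f g => f [[f1]] [g [[g1]]] /= /funext fg.
by move: f1 g1; rewrite fg => f1 g1; rewrite (Prop_irrelevance f1 g1).
Qed.

Lemma rmorphism_ext (A B : pzRingType) (f g : {rmorphism A -> B}) :
  f =1 g -> f = g.
Proof.
case: f g => f [[f1] [f2]] [g [[g1] [g2]]] /= /funext fg.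
move: f1 f2 g1 g2; rewrite fg => f1 f2 g1 g2.
by rewrite (Prop_irrelevance f1 g1) (Prop_irrelevance f2 g2).
Qed.

(* MathComp structures extend choiceType; types of morphisms get it from the
   classical axioms of boolp. *)

Section RingAutomorphisms.
Variable R : pzRingType.

Record ring_aut := RingAut {
  ra_fun :> {rmorphism R -> R};
  ra_inv : {rmorphism R -> R};
  ra_funK : cancel ra_fun ra_inv;
  ra_invK : cancel ra_inv ra_fun
}.

HB.instance Definition _ := gen_eqMixin ring_aut.
HB.instance Definition _ := gen_choiceMixin ring_aut.

Lemma ring_aut_ext (f g : ring_aut) : f =1 g -> f = g.
Proof.
case: f g => f f' fK f'K [g g' gK g'K] /= fg.
have fgE : f = g by exact: rmorphism_ext.
move: fK f'K gK g'K; rewrite -{}fgE => fK f'K gK g'K.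
have f'E : f' = g'.
  by apply: rmorphism_ext => x; rewrite -{1}[x]g'K fK.
move: fK f'K gK g'K; rewrite -{}f'E => fK f'K gK g'K.
by rewrite (Prop_irrelevance fK gK) (Prop_irrelevance f'K g'K).
Qed.

Definition ring_aut_one : ring_aut :=
  @RingAut (GRing.RMorphism.clone _ _ idfun _)
           (GRing.RMorphism.clone _ _ idfun _)
           (fun=> erefl) (fun=> erefl).

Definition ring_aut_inv (f : ring_aut) : ring_aut :=
  @RingAut (ra_inv f) f (@ra_invK f) (@ra_funK f).

Definition ring_aut_mul (f g : ring_aut) : ring_aut :=
  @RingAut (GRing.RMorphism.clone _ _ (f \o g) _)
           (GRing.RMorphism.clone _ _ (ra_inv g \o ra_inv f) _)
           (can_comp (@ra_funK f) (@ra_funK g))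
           (can_comp (@ra_invK g) (@ra_invK f)).

Lemma ring_aut_mulA : associative ring_aut_mul.
Proof. by move=> f g h; apply: ring_aut_ext. Qed.

Lemma ring_aut_mul1 : left_id ring_aut_one ring_aut_mul.
Proof. by move=> f; apply: ring_aut_ext. Qed.

Lemma ring_aut_mulr1 : right_id ring_aut_one ring_aut_mul.
Proof. by move=> f; apply: ring_aut_ext. Qed.

Lemma ring_aut_mulV : left_inverse ring_aut_one ring_aut_inv ring_aut_mul.
Proof. by move=> f; apply: ring_aut_ext => x; apply: ra_funK. Qed.

Lemma ring_aut_mulrV : right_inverse ring_aut_one ring_aut_inv ring_aut_mul.
Proof. by move=> f; apply: ring_aut_ext => x; apply: ra_invK. Qed.

HB.instance Definition _ := isGroup.Build ring_aut
  ring_aut_mulA ring_aut_mul1 ring_aut_mulr1 ring_aut_mulV ring_aut_mulrV.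

Lemma ring_aut1E (r : R) : (1%g : ring_aut) r = r. Proof. by []. Qed.

Lemma ring_autME (f g : ring_aut) (r : R) : (f * g)%g r = f (g r).
Proof. by []. Qed.

End RingAutomorphisms.

Section RingUnits.
Variable A : pzRingType.

(* The library's unitRingType excludes the zero ring, which occurs here as the
   endomorphism ring of the zero module. *)
Record ring_units := RingUnit {
  ru_val : A;
  ru_inv : A;
  ru_valV : ru_val * ru_inv = 1;
  ru_Vval : ru_inv * ru_val = 1
}.

HB.instance Definition _ := gen_eqMixin ring_units.
HB.instance Definition _ := gen_choiceMixin ring_units.

Lemma ring_units_ext (u v : ring_units) : ru_val u = ru_val v -> u = v.
Proof.
case: u v => u u' uV Vu [v v' vV Vv] /= uv.
move: uV Vu vV Vv; rewrite -{}uv => uV Vu vV Vv.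
have u'E : u' = v' by rewrite -[u']mulr1 -vV mulrA Vu mul1r.
move: uV Vu vV Vv; rewrite -{}u'E => uV Vu vV Vv.
by rewrite (Prop_irrelevance uV vV) (Prop_irrelevance Vu Vv).
Qed.

Definition ring_units_one : ring_units := RingUnit (mul1r 1) (mul1r 1).

Definition ring_units_inv (u : ring_units) : ring_units :=
  RingUnit (ru_Vval u) (ru_valV u).

Fact ring_units_mul_subproof (u v : ring_units) :
  (ru_val u * ru_val v) * (ru_inv v * ru_inv u) = 1.
Proof. by rewrite mulrA -(mulrA (ru_val u)) ru_valV mulr1 ru_valV. Qed.

Fact ring_units_mulV_subproof (u v : ring_units) :
  (ru_inv v * ru_inv u) * (ru_val u * ru_val v) = 1.
Proof. by rewrite mulrA -(mulrA (ru_inv v)) ru_Vval mulr1 ru_Vval. Qed.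

Definition ring_units_mul (u v : ring_units) : ring_units :=
  RingUnit (ring_units_mul_subproof u v) (ring_units_mulV_subproof u v).

Lemma ring_units_mulA : associative ring_units_mul.
Proof. by move=> u v w; apply: ring_units_ext; apply: mulrA. Qed.

Lemma ring_units_mul1 : left_id ring_units_one ring_units_mul.
Proof. by move=> u; apply: ring_units_ext; apply: mul1r. Qed.

Lemma ring_units_mulr1 : right_id ring_units_one ring_units_mul.
Proof. by move=> u; apply: ring_units_ext; apply: mulr1. Qed.

Lemma ring_units_mulV :
  left_inverse ring_units_one ring_units_inv ring_units_mul.
Proof. by move=> u; apply: ring_units_ext; apply: ru_Vval. Qed.

Lemma ring_units_mulrV :
  right_inverse ring_units_one ring_units_inv ring_units_mul.
Proof. by move=> u; apply: ring_units_ext; apply: ru_valV. Qed.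

HB.instance Definition _ := isGroup.Build ring_units
  ring_units_mulA ring_units_mul1 ring_units_mulr1
  ring_units_mulV ring_units_mulrV.

End RingUnits.

Section RingUnitsMap.
Variables (A B : pzRingType) (h : {rmorphism A -> B}).

Fact ring_units_map_subproof (u : ring_units A) :
  h (ru_val u) * h (ru_inv u) = 1.
Proof. by rewrite -rmorphM ru_valV rmorph1. Qed.

Fact ring_units_mapV_subproof (u : ring_units A) :
  h (ru_inv u) * h (ru_val u) = 1.
Proof. by rewrite -rmorphM ru_Vval rmorph1. Qed.

Definition ring_units_map (u : ring_units A) : ring_units B :=
  RingUnit (ring_units_map_subproof u) (ring_units_mapV_subproof u).

End RingUnitsMap.

Section EndomorphismRing.
Variable M : zmodType.

Record endAb := EndAb { end_fun :> {additive M -> M} }.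

HB.instance Definition _ := gen_eqMixin endAb.
HB.instance Definition _ := gen_choiceMixin endAb.

Lemma endAb_ext (f g : endAb) : f =1 g -> f = g.
Proof. by case: f g => f [g] /= /additive_ext ->. Qed.

Definition endAb_zero : endAb := EndAb (GRing.Additive.clone _ _ \0 _).
Definition endAb_opp (f : endAb) : endAb :=
  EndAb (GRing.Additive.clone _ _ (\- f) _).
Definition endAb_add (f g : endAb) : endAb :=
  EndAb (GRing.Additive.clone _ _ (f \+ g) _).
Definition endAb_one : endAb := EndAb (GRing.Additive.clone _ _ idfun _).
Definition endAb_mul (f g : endAb) : endAb :=
  EndAb (GRing.Additive.clone _ _ (f \o g) _).

Lemma endAb_addA : associative endAb_add.
Proof. by move=> f g h; apply: endAb_ext => m; apply: addrA. Qed.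
Lemma endAb_addC : commutative endAb_add.
Proof. by move=> f g; apply: endAb_ext => m; apply: addrC. Qed.
Lemma endAb_add0 : left_id endAb_zero endAb_add.
Proof. by move=> f; apply: endAb_ext => m; apply: add0r. Qed.
Lemma endAb_addN : left_inverse endAb_zero endAb_opp endAb_add.
Proof. by move=> f; apply: endAb_ext => m; apply: addNr. Qed.

HB.instance Definition _ := GRing.isZmodule.Build endAb
  endAb_addA endAb_addC endAb_add0 endAb_addN.

Lemma endAb_mulA : associative endAb_mul.
Proof. by move=> f g h; apply: endAb_ext. Qed.
Lemma endAb_mul1 : left_id endAb_one endAb_mul.
Proof. by move=> f; apply: endAb_ext. Qed.
Lemma endAb_mulr1 : right_id endAb_one endAb_mul.
Proof. by move=> f; apply: endAb_ext. Qed.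
Lemma endAb_mulDl : left_distributive endAb_mul +%R.
Proof. by move=> f g h; apply: endAb_ext. Qed.
Lemma endAb_mulDr : right_distributive endAb_mul +%R.
Proof. by move=> f g h; apply: endAb_ext => m; apply: raddfD. Qed.

HB.instance Definition _ := GRing.Zmodule_isPzRing.Build endAb
  endAb_mulA endAb_mul1 endAb_mulr1 endAb_mulDl endAb_mulDr.

Lemma endAb0E (m : M) : (0 : endAb) m = 0. Proof. by []. Qed.
Lemma endAb1E (m : M) : (1 : endAb) m = m. Proof. by []. Qed.
Lemma endAbDE (f g : endAb) (m : M) : (f + g) m = f m + g m.
Proof. by []. Qed.
Lemma endAbNE (f : endAb) (m : M) : (- f) m = - f m.
Proof. by []. Qed.
Lemma endAbME (f g : endAb) (m : M) : (f * g) m = f (g m).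
Proof. by []. Qed.

End EndomorphismRing.

Section ScalarEndomorphism.
Variables (R : pzRingType) (M : lmodType R).

Definition scale_end (r : R) : endAb M :=
  EndAb (GRing.Additive.clone _ _ ( *:%R r) _).

Lemma scale_endE (r : R) (m : M) : scale_end r m = r *: m. Proof. by []. Qed.

Fact scale_end_is_nmod_morphism : nmod_morphism scale_end.
Proof.
by split=> [|r s]; apply: endAb_ext => m; rewrite /= ?scale0r ?scalerDl.
Qed.

Fact scale_end_is_monoid_morphism : monoid_morphism scale_end.
Proof.
by split=> [|r s]; apply: endAb_ext => m; rewrite /= ?scale1r ?scalerA.
Qed.

HB.instance Definition _ :=
  GRing.isNmodMorphism.Build R (endAb M) scale_end scale_end_is_nmod_morphism.
HB.instance Definition _ :=
  GRing.isMonoidMorphism.Build R (endAb M) scale_end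
    scale_end_is_monoid_morphism.

End ScalarEndomorphism.

Section SliceCategories.
Variable R : pzRingType.

(* grp_over is Grp/Aut_Ring(R), ring_under is R/Ring; equality of morphisms is
   equality of the underlying functions, by proof irrelevance. *)
Record grp_over := GrpOver {
  go_grp :> groupType;
  go_map : {grphom go_grp -> ring_aut R}
}.

Record grp_over_hom (X Y : grp_over) := GrpOverHom {
  goh_fun :> {grphom X -> Y};
  goh_comm : forall x, go_map Y (goh_fun x) = go_map X x
}.

Fact grp_over_comp_subproof (X Y Z : grp_over)
    (g : grp_over_hom Y Z) (f : grp_over_hom X Y) (x : X) :
  go_map Z ((g \o f) x) = go_map X x.
Proof. by rewrite /= !goh_comm. Qed.

Definition grp_over_comp (X Y Z : grp_over)
    (g : grp_over_hom Y Z) (f : grp_over_hom X Y) : grp_over_hom X Z :=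
  @GrpOverHom X Z (UMagmaMorphism.clone _ _ (g \o f) _)
    (grp_over_comp_subproof g f).

Record ring_under := RingUnder {
  un_ring :> pzRingType;
  un_map : {rmorphism R -> un_ring}
}.

Record ring_under_hom (A B : ring_under) := RingUnderHom {
  ruh_fun :> {rmorphism A -> B};
  ruh_comm : forall r, ruh_fun (un_map A r) = un_map B r
}.

Fact ring_under_comp_subproof (A B C : ring_under)
    (g : ring_under_hom B C) (f : ring_under_hom A B) (r : R) :
  (g \o f) (un_map A r) = un_map C r.
Proof. by rewrite /= !ruh_comm. Qed.

Definition ring_under_comp (A B C : ring_under)
    (g : ring_under_hom B C) (f : ring_under_hom A B) : ring_under_hom A C :=
  @RingUnderHom A C (GRing.RMorphism.clone _ _ (g \o f) _)
    (ring_under_comp_subproof g f).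

End SliceCategories.

Section TwistedGroupRing.
Variables (R : pzRingType) (X : grp_over R).
Local Notation theta := (go_map X).

(* An alias of the additive group of the group ring (finitely supported
   functions X -> R), so that it can carry the twisted product. *)
Definition twisted : Type := {malg R[X]}.

HB.instance Definition _ := GRing.Zmodule.on twisted.

Implicit Types (a b c : twisted) (x y : X) (r s : R).

Definition twisted_one : twisted := << 1 *g 1%g >>.

Definition twisted_mul a b : twisted :=
  \sum_(x <- msupp a) \sum_(y <- msupp b)
    << a@_x * theta x (b@_y) *g (x * y)%g >>.

Lemma twisted_mulw (d e : {fset X}) a b :
  (msupp a `<=` d)%fset -> (msupp b `<=` e)%fset ->
  twisted_mul a b = \sum_(x <- d) \sum_(y <- e)
    << a@_x * theta x (b@_y) *g (x * y)%g >>.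
Proof.
move=> le_d le_e; rewrite /twisted_mul (big_fset_incl _ le_d) /=; last first.
  move=> x _ /mcoeff_outdom ->.
  by apply: big1 => y _; rewrite mul0r monalgU0.
apply: eq_bigr => x _; apply: big_fset_incl => // y _ /mcoeff_outdom ->.
by rewrite rmorph0 mulr0 monalgU0.
Qed.

Lemma twisted_mulDl : left_distributive twisted_mul +%R.
Proof.
move=> a b c; pose d := (msupp a `|` msupp b)%fset.
rewrite (twisted_mulw (d := d) (msuppD_le a b) (fsubset_refl _)).
rewrite (twisted_mulw (d := d) (fsubsetUl _ _) (fsubset_refl (msupp c))).
rewrite (twisted_mulw (d := d) (fsubsetUr _ _) (fsubset_refl (msupp c))).
rewrite -big_split; apply: eq_bigr => x _.
rewrite -big_split; apply: eq_bigr => y _.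
by rewrite /= mcoeffD mulrDl monalgUD.
Qed.

Lemma twisted_mulDr : right_distributive twisted_mul +%R.
Proof.
move=> c a b; pose d := (msupp a `|` msupp b)%fset.
rewrite (twisted_mulw (e := d) (fsubset_refl _) (msuppD_le a b)).
rewrite (twisted_mulw (e := d) (fsubset_refl (msupp c)) (fsubsetUl _ _)).
rewrite (twisted_mulw (e := d) (fsubset_refl (msupp c)) (fsubsetUr _ _)).
rewrite -big_split; apply: eq_bigr => x _.
rewrite -big_split; apply: eq_bigr => y _.
by rewrite /= mcoeffD rmorphD mulrDr monalgUD.
Qed.

Lemma twisted_mulUU r s x y :
  twisted_mul << r *g x >> << s *g y >> = << r * theta x s *g (x * y)%g >>.
Proof.
by rewrite (twisted_mulw msuppU_le msuppU_le) !big_seq_fset1 !mcoeffUU.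
Qed.

Lemma twisted_mul0 a : twisted_mul 0 a = 0.
Proof. by apply: (addrI (twisted_mul 0 a)); rewrite -twisted_mulDl !addr0. Qed.

Lemma twisted_mulr0 a : twisted_mul a 0 = 0.
Proof. by apply: (addrI (twisted_mul a 0)); rewrite -twisted_mulDr !addr0. Qed.

Lemma twisted_ind (P : twisted -> Prop) :
  P 0 -> (forall a b, P a -> P b -> P (a + b)) ->
  (forall r x, P << r *g x >>) -> forall a, P a.
Proof. by move=> P0 PD PU a; rewrite [a]monalgE; apply: big_ind. Qed.

Lemma twisted_mulA : associative twisted_mul.
Proof.
move=> a b c; elim/twisted_ind: a => [|a a' IH IH'|r x].
- by rewrite !twisted_mul0.
- by rewrite !twisted_mulDl IH IH'.
elim/twisted_ind: b => [|b b' IH IH'|s y].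
- by rewrite !(twisted_mul0, twisted_mulr0).
- by rewrite !(twisted_mulDl, twisted_mulDr) IH IH'.
elim/twisted_ind: c => [|c c' IH IH'|t z].
- by rewrite !twisted_mulr0.
- by rewrite !twisted_mulDr IH IH'.
by rewrite !twisted_mulUU gmulfM ring_autME rmorphM mulrA mulgA.
Qed.

Lemma twisted_mul1 : left_id twisted_one twisted_mul.
Proof.
elim/twisted_ind => [|a b IH IH'|r x]; first exact: twisted_mulr0.
  by rewrite twisted_mulDr IH IH'.
by rewrite twisted_mulUU gmulf1 ring_aut1E mul1r mul1g.
Qed.

Lemma twisted_mulr1 : right_id twisted_one twisted_mul.
Proof.
elim/twisted_ind => [|a b IH IH'|r x]; first exact: twisted_mul0.
  by rewrite twisted_mulDl IH IH'.
by rewrite twisted_mulUU rmorph1 mulr1 mulg1.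
Qed.

HB.instance Definition _ := GRing.Zmodule_isPzRing.Build twisted
  twisted_mulA twisted_mul1 twisted_mulr1 twisted_mulDl twisted_mulDr.

Lemma twistedMUU r s x y :
  (<< r *g x >> : twisted) * << s *g y >> = << r * theta x s *g (x * y)%g >>.
Proof. exact: twisted_mulUU. Qed.

Lemma twisted1E : (1 : twisted) = << 1 *g 1%g >>. Proof. by []. Qed.

Definition twisted_scalar r : twisted := << r *g 1%g >>.

Fact twisted_scalar_is_nmod_morphism : nmod_morphism twisted_scalar.
Proof. by split=> [|r s]; [apply: monalgU0 | apply: monalgUD]. Qed.

Fact twisted_scalar_is_monoid_morphism : monoid_morphism twisted_scalar.
Proof.
by split=> [|r s] //; rewrite [RHS]twistedMUU gmulf1 ring_aut1E mulg1.
Qed.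

HB.instance Definition _ := GRing.isNmodMorphism.Build R twisted
  twisted_scalar twisted_scalar_is_nmod_morphism.
HB.instance Definition _ := GRing.isMonoidMorphism.Build R twisted
  twisted_scalar twisted_scalar_is_monoid_morphism.

Definition twisted_under : ring_under R :=
  @RingUnder R twisted (GRing.RMorphism.clone _ _ twisted_scalar _).

End TwistedGroupRing.

Section TwistedGroupRingMap.
Variables (R : pzRingType) (X Y : grp_over R) (j : grp_over_hom X Y).

Definition twisted_map (a : twisted X) : twisted Y :=
  \sum_(x <- msupp a) << a@_x *g j x >>.

Lemma twisted_mapw (d : {fset X}) (a : twisted X) :
  (msupp a `<=` d)%fset -> twisted_map a = \sum_(x <- d) << a@_x *g j x >>.
Proof.
move=> le_d; rewrite /twisted_map (big_fset_incl _ le_d) //= => x _.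
by move=> /mcoeff_outdom ->; rewrite monalgU0.
Qed.

Lemma twisted_mapU (r : R) (x : X) : twisted_map << r *g x >> = << r *g j x >>.
Proof. by rewrite (twisted_mapw msuppU_le) big_seq_fset1 mcoeffUU. Qed.

Fact twisted_map_is_nmod_morphism : nmod_morphism twisted_map.
Proof.
split=> [|a b]; first by rewrite /twisted_map msupp0 big_seq_fset0.
pose d := (msupp a `|` msupp b)%fset.
rewrite (twisted_mapw (d := d) (msuppD_le a b)).
rewrite (twisted_mapw (d := d) (fsubsetUl _ _)).
rewrite (twisted_mapw (d := d) (fsubsetUr _ _)).
rewrite -big_split; apply: eq_bigr => x _.
by rewrite /= mcoeffD monalgUD.
Qed.

HB.instance Definition _ := GRing.isNmodMorphism.Build (twisted X) (twisted Y)
  twisted_map twisted_map_is_nmod_morphism.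

Fact twisted_map_is_monoid_morphism : monoid_morphism twisted_map.
Proof.
split=> [|a b]; first by rewrite twisted_mapU gmulf1.
elim/twisted_ind: a => [|a a' IH IH'|r x].
- by rewrite mul0r raddf0 mul0r.
- by rewrite mulrDl !raddfD /= IH IH' mulrDl.
elim/twisted_ind: b => [|b b' IH IH'|s y].
- by rewrite mulr0 raddf0 mulr0.
- by rewrite mulrDr !raddfD /= IH IH' mulrDr.
by rewrite twistedMUU !twisted_mapU twistedMUU goh_comm gmulfM.
Qed.

HB.instance Definition _ := GRing.isMonoidMorphism.Build
  (twisted X) (twisted Y) twisted_map twisted_map_is_monoid_morphism.

Fact twisted_map_comm_subproof (r : R) :
  twisted_map (un_map (twisted_under X) r) = un_map (twisted_under Y) r.
Proof. by rewrite [LHS]twisted_mapU gmulf1. Qed.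

Definition twisted_under_map :
    ring_under_hom (twisted_under X) (twisted_under Y) :=
  @RingUnderHom R (twisted_under X) (twisted_under Y)
    (GRing.RMorphism.clone _ _ twisted_map _) twisted_map_comm_subproof.

End TwistedGroupRingMap.

Section SemilinearAutomorphisms.
Variables (R : pzRingType) (M : lmodType R).

Definition end_under : ring_under R :=
  @RingUnder R (endAb M) (GRing.RMorphism.clone _ _ (@scale_end R M) _).

Record semi_aut := SemiAut {
  sa_map : ring_units (endAb M);
  sa_aut : ring_aut R;
  sa_comm : forall r : R,
    ru_val sa_map * scale_end M r = scale_end M (sa_aut r) * ru_val sa_map
}.

HB.instance Definition _ := gen_eqMixin semi_aut.
HB.instance Definition _ := gen_choiceMixin semi_aut.

Lemma semi_aut_ext (f g : semi_aut) :
  sa_map f = sa_map g -> sa_aut f = sa_aut g -> f = g.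
Proof.
case: f g => s p c [t q d] /= st pq.
move: c d; rewrite {}st {}pq => c d.
by rewrite (Prop_irrelevance c d).
Qed.

Fact semi_aut_one_subproof (r : R) :
  ru_val (1%g : ring_units (endAb M)) * scale_end M r
  = scale_end M ((1%g : ring_aut R) r) * ru_val (1%g : ring_units (endAb M)).
Proof. by rewrite mul1r mulr1. Qed.

Fact semi_aut_mul_subproof (f g : semi_aut) (r : R) :
  ru_val (sa_map f * sa_map g)%g * scale_end M r
  = scale_end M ((sa_aut f * sa_aut g)%g r) * ru_val (sa_map f * sa_map g)%g.
Proof. by rewrite -mulrA sa_comm mulrA sa_comm -mulrA. Qed.

Fact semi_aut_inv_subproof (f : semi_aut) (r : R) :
  ru_val (sa_map f)^-1%g * scale_end M r
  = scale_end M ((sa_aut f)^-1%g r) * ru_val (sa_map f)^-1%g.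
Proof.
set u := sa_map f; set p := sa_aut f.
have uV : ru_val u * ru_val u^-1%g = 1 by exact: ru_valV.
have Vu : ru_val u^-1%g * ru_val u = 1 by exact: ru_Vval.
rewrite -[scale_end M r]mulr1 -uV -{1}[r](ra_invK p) !mulrA.
by rewrite -[X in X * _]mulrA -sa_comm !mulrA Vu mul1r.
Qed.

Definition semi_aut_one : semi_aut := SemiAut semi_aut_one_subproof.
Definition semi_aut_mul (f g : semi_aut) : semi_aut :=
  SemiAut (semi_aut_mul_subproof f g).
Definition semi_aut_inv (f : semi_aut) : semi_aut :=
  SemiAut (semi_aut_inv_subproof f).

Lemma semi_aut_mulA : associative semi_aut_mul.
Proof. by move=> f g h; apply: semi_aut_ext; apply: mulgA. Qed.
Lemma semi_aut_mul1 : left_id semi_aut_one semi_aut_mul.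
Proof. by move=> f; apply: semi_aut_ext; apply: mul1g. Qed.
Lemma semi_aut_mulr1 : right_id semi_aut_one semi_aut_mul.
Proof. by move=> f; apply: semi_aut_ext; apply: mulg1. Qed.
Lemma semi_aut_mulV : left_inverse semi_aut_one semi_aut_inv semi_aut_mul.
Proof. by move=> f; apply: semi_aut_ext; apply: mulVg. Qed.
Lemma semi_aut_mulrV : right_inverse semi_aut_one semi_aut_inv semi_aut_mul.
Proof. by move=> f; apply: semi_aut_ext; apply: mulgV. Qed.

HB.instance Definition _ := isGroup.Build semi_aut
  semi_aut_mulA semi_aut_mul1 semi_aut_mulr1 semi_aut_mulV semi_aut_mulrV.

Fact sa_aut_is_monoid_morphism : monoid.monoid_morphism sa_aut.
Proof. by []. Qed.

HB.instance Definition _ := isUMagmaMorphism.Build semi_aut (ring_aut R)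
  sa_aut sa_aut_is_monoid_morphism.

Definition semi_aut_over : grp_over R :=
  @GrpOver R semi_aut (UMagmaMorphism.clone _ _ sa_aut _).

End SemilinearAutomorphisms.

Section SemilinearAutomorphismsMap.
Variables (R : pzRingType) (M N : lmodType R).
Variable h : ring_under_hom (end_under M) (end_under N).

Fact semi_aut_map_subproof (f : semi_aut M) (r : R) :
  ru_val (ring_units_map h (sa_map f)) * scale_end N r
  = scale_end N (sa_aut f r) * ru_val (ring_units_map h (sa_map f)).
Proof.
have hE s : h (scale_end M s) = scale_end N s by exact: (ruh_comm h).
by rewrite /= -!hE -!rmorphM sa_comm.
Qed.

Definition semi_aut_map (f : semi_aut M) : semi_aut N :=
  SemiAut (semi_aut_map_subproof f).

Fact semi_aut_map_is_monoid_morphism : monoid.monoid_morphism semi_aut_map.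
Proof.
split=> [|f g]; apply: semi_aut_ext => //; apply: ring_units_ext.
  exact: rmorph1.
exact: rmorphM.
Qed.

HB.instance Definition _ := isUMagmaMorphism.Build (semi_aut M) (semi_aut N)
  semi_aut_map semi_aut_map_is_monoid_morphism.

Definition semi_aut_over_map :
    grp_over_hom (semi_aut_over M) (semi_aut_over N) :=
  @GrpOverHom R (semi_aut_over M) (semi_aut_over N)
    (UMagmaMorphism.clone _ _ semi_aut_map _) (fun=> erefl).

End SemilinearAutomorphismsMap.

Section ModuleExtensionsAndActions.
Variables (R : pzRingType) (X : grp_over R) (M : lmodType R).

Definition phi_semilinear (phi : ring_aut R) (N : lmodType R) (f : M -> N) : Prop :=
  {morph f : m m' / m + m'} /\ (forall (r : R) m, f (r *: m) = phi r *: f m).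

(* The module laws are those of GRing.Zmodule_isLmodule, over the abelian group
   underlying M. *)
Record module_extension := ModuleExtension {
  me_scale :> twisted X -> M -> M;
  me_scaleA : forall a b m, me_scale a (me_scale b m) = me_scale (a * b) m;
  me_scale1 : left_id 1 me_scale;
  me_scaleDr : right_distributive me_scale +%R;
  me_scaleDl : forall m, {morph me_scale^~ m : a b / a + b};
  me_ext : forall (r : R) m, me_scale (un_map (twisted_under X) r) m = r *: m
}.

Record semilinear_action := SemilinearAction {
  sla_act :> X -> M -> M;
  sla_semilinear : forall x, phi_semilinear (go_map X x) (sla_act x);
  sla_act1 : forall m, sla_act 1%g m = m;
  sla_actM : forall x y m, sla_act (x * y)%g m = sla_act x (sla_act y m)
}.

End ModuleExtensionsAndActions.

(* Main.v *)
Require Import Defs.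
From HB Require Import structures.
From mathcomp Require Import all_boot all_algebra finmap monalg.
From mathcomp Require Import boolp.

Set Implicit Arguments.
Unset Strict Implicit.
Unset Printing Implicit Defensive.

Import GRing.Theory.
Local Open Scope ring_scope.

(** The twisted group ring [R_theta[G]] is generated by [R] and the group
elements [g], subject to [g r = theta_g(r) g].  Hence a ring homomorphism under
[R] from it to [A] is the same as a unital multiplicative map [u : G -> A] with
[u(g) r = theta_g(r) u(g)] in [A]: [twisted_lift] constructs the homomorphism
from [u], and [twisted_under_hom_ext] says that it is the only one.

For [A = End_Ab(M)] the commutation rule says exactly that [u(g)] is
[theta_g]-semilinear.  Each [u(g)] is invertible with inverse [u(g^-1)], because
[G] is a group and [u] is unital and multiplicative, so [u] amounts to a
homomorphism [g |-> (u(g), theta_g)] into the semilinear automorphisms of [M] whose second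
component is [theta].  This is the bijection, [action_of_hom] with inverse
[hom_of_action].  Both naturality squares can be checked on the first components
only ([semi_aut_over_hom_ext]), where they hold by computation on generators.

The two concrete descriptions are currying: a module law [s] on [M] is the ring
homomorphism [a |-> s a], and an action [s] by semilinear maps is the group
homomorphism [g |-> (s g, theta_g)]. *)

(** * Extensionality of morphisms and module structures *)

Lemma grphom_ext (G H : groupType) (f g : {grphom G -> H}) : f =1 g -> f = g.
Proof.
case: f g => f [[f1] [f2]] [g [[g1] [g2]]] /= /funext fg.
move: f1 f2 g1 g2; rewrite fg => f1 f2 g1 g2.
by rewrite (Prop_irrelevance f1 g1) (Prop_irrelevance f2 g2).
Qed.

Section SliceExtensionality.
Variable R : pzRingType.

Lemma grp_over_hom_ext (X Y : grp_over R) (f g : grp_over_hom X Y) :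
  f =1 g -> f = g.
Proof.
case: f g => f fc [g gc] /= /grphom_ext fg.
by move: fc gc; rewrite fg => fc gc; rewrite (Prop_irrelevance fc gc).
Qed.

Lemma ring_under_hom_ext (A B : ring_under R) (f g : ring_under_hom A B) :
  f =1 g -> f = g.
Proof.
case: f g => f fc [g gc] /= /rmorphism_ext fg.
by move: fc gc; rewrite fg => fc gc; rewrite (Prop_irrelevance fc gc).
Qed.

Lemma module_extension_ext (X : grp_over R) (M : lmodType R)
    (s t : module_extension X M) : s =2 t -> s = t.
Proof.
case: s t => s s1 s2 s3 s4 s5 [t t1 t2 t3 t4 t5] /= st.
have {}st : s = t by apply/funext => a; apply/funext => m; apply: st.
move: s1 s2 s3 s4 s5 t1 t2 t3 t4 t5; rewrite st => s1 s2 s3 s4 s5 *.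
by congr ModuleExtension; apply: Prop_irrelevance.
Qed.

Lemma semilinear_action_ext (X : grp_over R) (M : lmodType R)
    (s t : semilinear_action X M) : s =2 t -> s = t.
Proof.
case: s t => s s1 s2 s3 [t t1 t2 t3] /= st.
have {}st : s = t by apply/funext => a; apply/funext => m; apply: st.
move: s1 s2 s3 t1 t2 t3; rewrite st => *.
by congr SemilinearAction; apply: Prop_irrelevance.
Qed.

End SliceExtensionality.

(** * The universal property of the twisted group ring *)

Section TwistedUniversalProperty.
Variables (R : pzRingType) (X : grp_over R) (A : ring_under R).

Definition twisted_gen (x : X) : twisted X := << 1 *g x >>.

Lemma twisted_genM x y : twisted_gen (x * y)%g = twisted_gen x * twisted_gen y.
Proof. by rewrite [RHS]twistedMUU rmorph1 mulr1. Qed.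

(** Monomials span additively, so this factorization is why [R] and the group
elements generate the twisted group ring. *)
Lemma twistedUE (r : R) (x : X) :
  << r *g x >> = un_map (twisted_under X) r * twisted_gen x :> twisted X.
Proof. by rewrite [RHS]twistedMUU rmorph1 mulr1 mul1g. Qed.

(** The defining relation of the twist; the image of this identity under a
homomorphism to an endomorphism ring is semilinearity. *)
Lemma twisted_gen_comm (x : X) (r : R) :
  twisted_gen x * un_map (twisted_under X) r
  = un_map (twisted_under X) (go_map X x r) * twisted_gen x.
Proof. by rewrite -twistedUE [LHS]twistedMUU mul1r mulg1. Qed.

Lemma twisted_under_hom_ext (F F' : ring_under_hom (twisted_under X) A) :
  (forall x, F (twisted_gen x) = F' (twisted_gen x)) -> F = F'.
Proof.
move=> FF'; apply: ring_under_hom_ext => a.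
elim/twisted_ind: a => [|a b IH IH'|r x].
- by rewrite !rmorph0.
- by rewrite !rmorphD IH IH'.
by rewrite twistedUE !rmorphM FF' !ruh_comm.
Qed.

Section Lift.
Variable u : X -> A.
Hypothesis u1 : u 1%g = 1.
Hypothesis uM : forall x y, u (x * y)%g = u x * u y.
Hypothesis u_comm :
  forall x r, u x * un_map A r = un_map A (go_map X x r) * u x.

Definition twisted_lift_fun (a : twisted X) : A :=
  \sum_(x <- msupp a) un_map A a@_x * u x.

(** Summing over any finite superset of the support allows two elements to be
added over a common index set. *)
Lemma twisted_lift_funw (d : {fset X}) (a : twisted X) :
  (msupp a `<=` d)%fset ->
  twisted_lift_fun a = \sum_(x <- d) un_map A a@_x * u x.
Proof.
move=> le_d; rewrite /twisted_lift_fun (big_fset_incl _ le_d) //= => x _.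
by move=> /mcoeff_outdom ->; rewrite rmorph0 mul0r.
Qed.

Lemma twisted_lift_funU (r : R) (x : X) :
  twisted_lift_fun << r *g x >> = un_map A r * u x.
Proof. by rewrite (twisted_lift_funw msuppU_le) big_seq_fset1 mcoeffUU. Qed.

Fact twisted_lift_is_nmod_morphism : nmod_morphism twisted_lift_fun.
Proof.
split=> [|a b]; first by rewrite /twisted_lift_fun msupp0 big_seq_fset0.
pose d := (msupp a `|` msupp b)%fset.
rewrite (twisted_lift_funw (d := d) (msuppD_le a b)).
rewrite (twisted_lift_funw (d := d) (fsubsetUl _ _)).
rewrite (twisted_lift_funw (d := d) (fsubsetUr _ _)).
rewrite -big_split; apply: eq_bigr => x _.
by rewrite /= mcoeffD rmorphD mulrDl.
Qed.

HB.instance Definition _ := GRing.isNmodMorphism.Build (twisted X) A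
  twisted_lift_fun twisted_lift_is_nmod_morphism.

(** Both sides are biadditive, so it suffices to compare them on monomials; there
moving [u x] past the coefficient [s] by [u_comm] produces the twist
[theta_x(s)] of the product in the source. *)
Fact twisted_lift_is_monoid_morphism : monoid_morphism twisted_lift_fun.
Proof.
split=> [|a b]; first by rewrite twisted_lift_funU u1 rmorph1 mulr1.
elim/twisted_ind: a => [|a a' IH IH'|r x].
- by rewrite mul0r raddf0 mul0r.
- by rewrite mulrDl !raddfD /= IH IH' mulrDl.
elim/twisted_ind: b => [|b b' IH IH'|s y].
- by rewrite mulr0 raddf0 mulr0.
- by rewrite mulrDr !raddfD /= IH IH' mulrDr.
rewrite twistedMUU !twisted_lift_funU rmorphM uM -!mulrA; congr (_ * _).
by rewrite !mulrA u_comm.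
Qed.

HB.instance Definition _ := GRing.isMonoidMorphism.Build (twisted X) A
  twisted_lift_fun twisted_lift_is_monoid_morphism.

Fact twisted_lift_comm (r : R) :
  twisted_lift_fun (un_map (twisted_under X) r) = un_map A r.
Proof. by rewrite [LHS]twisted_lift_funU u1 mulr1. Qed.

Definition twisted_lift : ring_under_hom (twisted_under X) A :=
  @RingUnderHom R (twisted_under X) A
    (GRing.RMorphism.clone _ _ twisted_lift_fun _) twisted_lift_comm.

Lemma twisted_lift_gen x : twisted_lift (twisted_gen x) = u x.
Proof. by rewrite [LHS]twisted_lift_funU rmorph1 mul1r. Qed.

End Lift.
End TwistedUniversalProperty.

Lemma twisted_map_gen (R : pzRingType) (X Y : grp_over R)
    (j : grp_over_hom X Y) (x : X) :
  twisted_under_map j (twisted_gen x) = twisted_gen (j x).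
Proof. exact: twisted_mapU. Qed.

(** * Ring homomorphisms under R and semilinear actions *)

(** The second component of a semilinear automorphism in the image is forced,
since a morphism over [Aut(R)] must have [theta] there. *)
Lemma semi_aut_over_hom_ext (R : pzRingType) (X : grp_over R) (M : lmodType R)
    (f g : grp_over_hom X (semi_aut_over M)) :
  (forall x, ru_val (sa_map (f x : semi_aut M))
             = ru_val (sa_map (g x : semi_aut M))) -> f = g.
Proof.
move=> fg; apply: grp_over_hom_ext => x; apply: semi_aut_ext.
  exact: ring_units_ext.
by rewrite [LHS](goh_comm f) [RHS](goh_comm g).
Qed.

Section Adjunction.
Variables (R : pzRingType) (X : grp_over R) (M : lmodType R).

Section FromTwisted.
Variable F : ring_under_hom (twisted_under X) (end_under M).

(** Group elements are units of the twisted group ring, hence so are their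
images. *)
Fact gen_unit_valV x : F (twisted_gen x) * F (twisted_gen x^-1%g) = 1.
Proof. by rewrite -rmorphM -twisted_genM mulgV rmorph1. Qed.

Fact gen_unit_Vval x : F (twisted_gen x^-1%g) * F (twisted_gen x) = 1.
Proof. by rewrite -rmorphM -twisted_genM mulVg rmorph1. Qed.

Definition gen_unit (x : X) : ring_units (endAb M) :=
  RingUnit (gen_unit_valV x) (gen_unit_Vval x).

Fact gen_semi_aut_comm x (r : R) :
  ru_val (gen_unit x) * scale_end M r
  = scale_end M (go_map X x r) * ru_val (gen_unit x).
Proof.
have FE s : scale_end M s = F (un_map (twisted_under X) s).
  by rewrite (ruh_comm F).
by rewrite !FE -[LHS]rmorphM -[RHS]rmorphM twisted_gen_comm.
Qed.

Definition gen_semi_aut (x : X) : semi_aut_over M :=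
  SemiAut (gen_semi_aut_comm x).

Fact gen_semi_aut_is_monoid_morphism : monoid.monoid_morphism gen_semi_aut.
Proof.
split=> [|x y]; apply: semi_aut_ext; rewrite /= ?gmulf1 ?gmulfM //.
  by apply: ring_units_ext; apply: rmorph1.
by apply: ring_units_ext; rewrite /= twisted_genM rmorphM.
Qed.

HB.instance Definition _ := isUMagmaMorphism.Build X (semi_aut_over M)
  gen_semi_aut gen_semi_aut_is_monoid_morphism.

Definition action_of_hom : grp_over_hom X (semi_aut_over M) :=
  @GrpOverHom R X (semi_aut_over M)
    (UMagmaMorphism.clone _ _ gen_semi_aut _) (fun=> erefl).

End FromTwisted.

Section ToTwisted.
Variable f : grp_over_hom X (semi_aut_over M).

Definition action_end (x : X) : end_under M :=
  ru_val (sa_map (f x : semi_aut M)).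

Fact action_end1 : action_end 1%g = 1.
Proof. by rewrite /action_end gmulf1. Qed.

Fact action_endM x y : action_end (x * y)%g = action_end x * action_end y.
Proof. by rewrite /action_end gmulfM. Qed.

Fact action_end_comm x (r : R) :
  action_end x * un_map (end_under M) r
  = un_map (end_under M) (go_map X x r) * action_end x.
Proof. by rewrite -(goh_comm f); apply: sa_comm. Qed.

Definition hom_of_action : ring_under_hom (twisted_under X) (end_under M) :=
  twisted_lift action_end1 action_endM action_end_comm.

End ToTwisted.

Lemma action_of_homK : cancel action_of_hom hom_of_action.
Proof.
by move=> F; apply: twisted_under_hom_ext => x; rewrite twisted_lift_gen.
Qed.

Lemma hom_of_actionK : cancel hom_of_action action_of_hom.
Proof.
move=> f; apply: semi_aut_over_hom_ext => x.
exact: (twisted_lift_gen (action_end1 f) (action_endM f) (action_end_comm f) x).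
Qed.

End Adjunction.

(** * Module structures as ring homomorphisms *)

Lemma morphD_is_nmod_morphism (U V : zmodType) (f : U -> V) :
  {morph f : x y / x + y} -> nmod_morphism f.
Proof. by move=> fD; split=> //; apply: (addrI (f 0)); rewrite -fD !addr0. Qed.

Section ModuleExtensions.
Variables (R : pzRingType) (X : grp_over R) (M : lmodType R).

Section ExtensionOfHom.
Variable F : ring_under_hom (twisted_under X) (end_under M).
Let scale (a : twisted X) (m : M) : M := (F a : endAb M) m.

Fact hom_scaleA a b m : scale a (scale b m) = scale (a * b) m.
Proof. by rewrite /scale rmorphM. Qed.
Fact hom_scale1 : left_id 1 scale.
Proof. by move=> m; rewrite /scale rmorph1. Qed.
Fact hom_scaleDr : right_distributive scale +%R.
Proof. by move=> a m m'; apply: raddfD. Qed.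
Fact hom_scaleDl m : {morph scale^~ m : a b / a + b}.
Proof. by move=> a b; rewrite /scale raddfD. Qed.
Fact hom_scale_ext (r : R) m : scale (un_map (twisted_under X) r) m = r *: m.
Proof. by rewrite /scale ruh_comm. Qed.

Definition extension_of_hom : module_extension X M :=
  ModuleExtension hom_scaleA hom_scale1 hom_scaleDr hom_scaleDl hom_scale_ext.

End ExtensionOfHom.

Section HomOfExtension.
Variable s : module_extension X M.

Fact me_scale_is_nmod_morphism a : nmod_morphism (s a).
Proof.
exact/morphD_is_nmod_morphism/me_scaleDr.
Qed.

HB.instance Definition _ a := GRing.isNmodMorphism.Build M M
  (s a) (me_scale_is_nmod_morphism a).

Definition me_end (a : twisted X) : end_under M :=
  EndAb (GRing.Additive.clone _ _ (s a) _).

Fact me_end_is_nmod_morphism : nmod_morphism me_end.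
Proof.
apply: morphD_is_nmod_morphism => a b; apply: endAb_ext => m.
exact: me_scaleDl.
Qed.

Fact me_end_is_monoid_morphism : monoid_morphism me_end.
Proof.
split=> [|a b]; apply: endAb_ext => m; first exact: me_scale1.
by rewrite /= -me_scaleA.
Qed.

HB.instance Definition _ := GRing.isNmodMorphism.Build
  (twisted X) (end_under M) me_end me_end_is_nmod_morphism.
HB.instance Definition _ := GRing.isMonoidMorphism.Build
  (twisted X) (end_under M) me_end me_end_is_monoid_morphism.

Fact me_end_comm (r : R) :
  me_end (un_map (twisted_under X) r) = un_map (end_under M) r.
Proof. by apply: endAb_ext => m; apply: me_ext. Qed.

Definition hom_of_extension :
    ring_under_hom (twisted_under X) (end_under M) :=
  @RingUnderHom R (twisted_under X) (end_under M)
    (GRing.RMorphism.clone _ _ me_end _) me_end_comm.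

End HomOfExtension.

Lemma extension_of_homK : cancel extension_of_hom hom_of_extension.
Proof.
by move=> F; apply: ring_under_hom_ext => a; apply: endAb_ext.
Qed.

Lemma hom_of_extensionK : cancel hom_of_extension extension_of_hom.
Proof. by move=> s; apply: module_extension_ext. Qed.

End ModuleExtensions.

(** * Semilinear actions as group homomorphisms *)

Section SemilinearActions.
Variables (R : pzRingType) (X : grp_over R) (M : lmodType R).

Section ActionOfSlice.
Variable f : grp_over_hom X (semi_aut_over M).
Let act (x : X) (m : M) : M := ru_val (sa_map (f x : semi_aut M)) m.

(** The second component of [f x] is [theta_x] because [f] lies over [Aut(R)];
the commutation rule of a semilinear automorphism, evaluated at [m], is then
semilinearity. *)
Fact slice_act_semilinear x : phi_semilinear (go_map X x) (act x).
Proof.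
split=> [m m'|r m]; first exact: raddfD.
have := sa_comm (f x) r; rewrite [sa_aut _](goh_comm f).
by move=> /(congr1 (fun e : endAb M => e m)).
Qed.

Fact slice_act1 m : act 1%g m = m.
Proof. by rewrite /act gmulf1. Qed.

Fact slice_actM x y m : act (x * y)%g m = act x (act y m).
Proof. by rewrite /act gmulfM. Qed.

Definition slice_action : semilinear_action X M :=
  SemilinearAction slice_act_semilinear slice_act1 slice_actM.

End ActionOfSlice.

Section SliceOfAction.
Variable s : semilinear_action X M.

Fact sla_act_is_nmod_morphism x : nmod_morphism (s x).
Proof.
by have [/morphD_is_nmod_morphism] := sla_semilinear s x.
Qed.

HB.instance Definition _ x := GRing.isNmodMorphism.Build M M
  (s x) (sla_act_is_nmod_morphism x).

Definition sla_end (x : X) : endAb M :=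
  EndAb (GRing.Additive.clone _ _ (s x) _).

Fact sla_end1 : sla_end 1%g = 1.
Proof. by apply: endAb_ext => m; apply: sla_act1. Qed.

Fact sla_endM x y : sla_end (x * y)%g = sla_end x * sla_end y.
Proof. by apply: endAb_ext => m; apply: sla_actM. Qed.

Fact sla_end_valV x : sla_end x * sla_end x^-1%g = 1.
Proof. by rewrite -sla_endM mulgV sla_end1. Qed.

Fact sla_end_Vval x : sla_end x^-1%g * sla_end x = 1.
Proof. by rewrite -sla_endM mulVg sla_end1. Qed.

Fact sla_end_comm x (r : R) :
  sla_end x * scale_end M r = scale_end M (go_map X x r) * sla_end x.
Proof.
by apply: endAb_ext => m; have [_] := sla_semilinear s x; apply.
Qed.

Definition sla_semi_aut (x : X) : semi_aut_over M :=
  @SemiAut R M (RingUnit (sla_end_valV x) (sla_end_Vval x)) (go_map X x)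
    (sla_end_comm x).

Fact sla_semi_aut_is_monoid_morphism : monoid.monoid_morphism sla_semi_aut.
Proof.
split=> [|x y]; apply: semi_aut_ext; rewrite /= ?gmulf1 ?gmulfM //.
  by apply: ring_units_ext; apply: sla_end1.
by apply: ring_units_ext; apply: sla_endM.
Qed.

HB.instance Definition _ := isUMagmaMorphism.Build X (semi_aut_over M)
  sla_semi_aut sla_semi_aut_is_monoid_morphism.

Definition slice_of_action : grp_over_hom X (semi_aut_over M) :=
  @GrpOverHom R X (semi_aut_over M)
    (UMagmaMorphism.clone _ _ sla_semi_aut _) (fun=> erefl).

End SliceOfAction.

Lemma slice_actionK : cancel slice_action slice_of_action.
Proof.
by move=> f; apply: semi_aut_over_hom_ext => x; apply: endAb_ext.
Qed.

Lemma slice_of_actionK : cancel slice_of_action slice_action.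
Proof. by move=> s; apply: semilinear_action_ext. Qed.

End SemilinearActions.

Theorem corollary3p6 (R : pzRingType) :
  [/\ exists Phi : forall (X : grp_over R) (M : lmodType R),
        ring_under_hom (twisted_under X) (end_under M) ->
        grp_over_hom X (semi_aut_over M),
      [/\ forall (X : grp_over R) (M : lmodType R), bijective (@Phi X M),
          forall (X Y : grp_over R) (j : grp_over_hom X Y) (M : lmodType R)
                 (F : ring_under_hom (twisted_under Y) (end_under M)),
            Phi X M (ring_under_comp F (twisted_under_map j))
            = grp_over_comp (Phi Y M F) j
        & forall (X : grp_over R) (M N : lmodType R)
                 (h : ring_under_hom (end_under M) (end_under N))
                 (F : ring_under_hom (twisted_under X) (end_under M)),
            Phi X N (ring_under_comp h F)
            = grp_over_comp (semi_aut_over_map h) (Phi X M F)],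
      forall (X : grp_over R) (M : lmodType R),
        exists Psi : ring_under_hom (twisted_under X) (end_under M) ->
                     module_extension X M,
          bijective Psi /\
          forall F (a : twisted X) (m : M), Psi F a m = (F a : endAb M) m
    & forall (X : grp_over R) (M : lmodType R),
        exists Ups : grp_over_hom X (semi_aut_over M) ->
                     semilinear_action X M,
          bijective Ups /\
          forall f (x : X) (m : M),
            Ups f x m = ru_val (sa_map (f x : semi_aut M)) m].
Proof.
split.
- exists (@action_of_hom R); split.
  + by move=> X M; exists (@hom_of_action R X M);
      [apply: action_of_homK | apply: hom_of_actionK].
  + move=> X Y j M F; apply: semi_aut_over_hom_ext => x.
    (* the map induced by j sends the generator x to the generator j x *)
    by rewrite /= -[in RHS]twisted_map_gen.
  + by move=> X M N h F; apply: semi_aut_over_hom_ext.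
- move=> X M; exists (@extension_of_hom R X M); split=> //.
  exists (@hom_of_extension R X M).
    exact: extension_of_homK.
  exact: hom_of_extensionK.
move=> X M; exists (@slice_action R X M); split=> //.
exists (@slice_of_action R X M).
  exact: slice_actionK.
exact: slice_of_actionK.
Qed.
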